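(* Let $d\ge1$ and let $\mathbf X$ be a random vector in $\mathbb R^d$ with law $\mathbb P$ such that $\mathbb E\|\mathbf X\|<\infty$. Then for every $\delta>0$ there exist two constants $0<c_1<c_2$ such that $$c_1\|\mathbf z\|^{-1}\le D_\delta(\mathbf z|\mathbb P)\le c_2\|\mathbf z\|^{-1}$$ when $\|\mathbf z\|$ is large enough.
   Context: $\|\cdot\|$ is the Euclidean norm and $\langle\cdot,\cdot\rangle$ the Euclidean inner product. For laws $\mathbb P,\mathbb P'$ on $\mathbb R^d$ the Wasserstein distance is $d_W(\mathbb P,\mathbb P')=\inf_\Pi\int\|\mathbf x-\mathbf y\|\,\Pi(\mathrm d\mathbf x,\mathrm d\mathbf y)\in[0,\infty]$, over all joint laws $\Pi$ with marginals $\mathbb P,\mathbb P'$. The robustified halfspace depth is $$D_\delta(\mathbf z|\mathbb P)=\inf_{\|\mathbf u\|=1}\ \sup_{\mathbb P':d_W(\mathbb P',\mathbb P)\le\delta}\mathbb P'(\{\mathbf x\in\mathbb R^d:\langle\mathbf u,\mathbf x-\mathbf z\rangle\ge0\}).$$ *)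

(* Defs.v *)
From HB Require Import structures.
From mathcomp Require Import all_boot all_order all_algebra.
From mathcomp Require Import all_classical all_reals all_analysis.
Set Implicit Arguments.
Unset Strict Implicit.
Unset Printing Implicit Defensive.
Import Order.TTheory GRing.Theory Num.Theory.
Local Open Scope classical_set_scope.
Local Open Scope ring_scope.

(* R^d is d.-tuple R: its canonical sigma-algebra is the one generated by the
   coordinate maps, i.e. the Borel sigma-algebra of R^d.  (The norm that the
   library puts on row vectors is the sup norm, not the Euclidean one.) *)
Section euclidean_space.
Variables (R : realType) (d : nat).
Implicit Types x y : d.-tuple R.

Definition vsub x y : d.-tuple R := [tuple tnth x i - tnth y i | i < d].

Definition inner x y : R := \sum_(i < d) tnth x i * tnth y i.

Definition enorm x : R := Num.sqrt (inner x x).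

Definition halfspace (u z : d.-tuple R) : set (d.-tuple R) :=
  [set x | 0 <= inner u (vsub x z)].

End euclidean_space.

Section robust_depth.
Variables (R : realType) (d : nat).
Local Open Scope ereal_scope.

Definition coupling (P P' : probability (d.-tuple R) R) :
    set (probability (d.-tuple R * d.-tuple R)%type R) :=
  [set Pi | forall A : set (d.-tuple R), measurable A ->
    pushforward Pi fst A = P A /\ pushforward Pi snd A = P' A].

Definition wasserstein (P P' : probability (d.-tuple R) R) : \bar R :=
  ereal_inf [set \int[Pi]_w (enorm (vsub w.1 w.2))%:E | Pi in coupling P P'].

Definition robust_depth (delta : R) (P : probability (d.-tuple R) R)
    (z : d.-tuple R) : \bar R :=
  ereal_inf [set ereal_sup
      [set P' (halfspace u z) |
        P' in [set P' : probability (d.-tuple R) R |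
                 wasserstein P' P <= delta%:E]]
    | u in [set u : d.-tuple R | enorm u = 1%R]].

End robust_depth.

(* Main.v *)
Require Import Defs.
From HB Require Import structures.
From mathcomp Require Import all_boot all_order all_algebra.
From mathcomp Require Import ring lra.
From mathcomp Require Import all_classical all_reals all_analysis.
From mathcomp Require Import measurable_realfun.
Set Implicit Arguments.
Unset Strict Implicit.
Unset Printing Implicit Defensive.
Import Order.TTheory GRing.Theory Num.Theory.
Local Open Scope classical_set_scope.
Local Open Scope ring_scope.

(** Upper bound: in the direction [u = z / |z|], every point of the halfspace
    has norm at least [|z|], so Markov's inequality bounds the mass it has under
    [P'] by [m(P') / |z|], where the first moment [m] satisfies
    [m(P') <= d_W(P', P) + m(P)].  Lower bound: moving a fraction [p] of the
    mass of [P] to [z], which belongs to every halfspace through [z], costs at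
    most [p (|z| + m(P))], and this is at most [delta] for some [p] of order
    [delta / |z|]. *)

Section euclidean_space_theory.
Variables (R : realType) (d : nat).
Implicit Types (u x y z : d.-tuple R).

Lemma innerC x y : inner x y = inner y x.
Proof. by apply: eq_bigr => i _; rewrite mulrC. Qed.

Lemma inner_vsubr u x y : inner u (vsub x y) = inner u x - inner u y.
Proof.
by rewrite /inner -sumrB; apply: eq_bigr => i _; rewrite tnth_mktuple mulrBr.
Qed.

Lemma inner_vsubl u x y : inner (vsub x y) u = inner x u - inner y u.
Proof. by rewrite innerC inner_vsubr ![inner u _]innerC. Qed.

Lemma inner_self_ge0 x : 0 <= inner x x.
Proof. by apply: sumr_ge0 => i _; rewrite -expr2 sqr_ge0. Qed.

Lemma vsubKr x y : vsub x (vsub x y) = y.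
Proof. by apply: eq_from_tnth => i; rewrite !tnth_mktuple subKr. Qed.

Lemma enorm_ge0 x : 0 <= enorm x.
Proof. exact: sqrtr_ge0. Qed.

Lemma EFin_enorm_ge0 x : (0 <= (enorm x)%:E)%E.
Proof. by rewrite lee_fin enorm_ge0. Qed.

Lemma sqr_enorm x : enorm x ^+ 2 = inner x x.
Proof. by rewrite sqr_sqrtr// inner_self_ge0. Qed.

Lemma enorm_vsubC x y : enorm (vsub x y) = enorm (vsub y x).
Proof. by congr Num.sqrt; rewrite !inner_vsubl !inner_vsubr; ring. Qed.

Lemma enorm_vsubxx x : enorm (vsub x x) = 0.
Proof. by rewrite /enorm inner_vsubl subrr sqrtr0. Qed.

Lemma inner_CauchySchwarz x y : `|inner x y| <= enorm x * enorm y.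
Proof.
pose q := Poly [:: inner y y; 2 * inner x y; inner x x].
have q_ge0 t : 0 <= q.[t].
  suff -> : q.[t] = \sum_(i < d) (t * tnth x i + tnth y i) ^+ 2.
    by apply: sumr_ge0 => i _; exact: sqr_ge0.
  transitivity (inner x x * t ^+ 2 + 2 * t * inner x y + inner y y).
    by rewrite horner_Poly/=; ring.
  rewrite /inner mulr_suml mulr_sumr -!big_split/=.
  by apply: eq_bigr => i _; ring.
have := @deg_le2_poly_ge0 _ q (size_Poly _) q_ge0.
rewrite !coef_Poly/= => discr_le0.
rewrite /enorm -sqrtrM ?inner_self_ge0// -sqrtr_sqr ler_wsqrtr//.
by lra.
Qed.

Lemma ler_enormB x y : enorm (vsub x y) <= enorm x + enorm y.
Proof.
rewrite -ler_sqr ?nnegrE ?addr_ge0 ?enorm_ge0//.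
rewrite sqr_enorm inner_vsubl !inner_vsubr (innerC y x) -!sqr_enorm.
by have /ler_normlP[] := inner_CauchySchwarz x y; lra.
Qed.

Lemma lerB_enormB x y : enorm x - enorm y <= enorm (vsub x y).
Proof. by rewrite lerBlDl enorm_vsubC -[in leLHS](vsubKr y x) ler_enormB. Qed.

Lemma inner_le_enorm u x : enorm u = 1 -> inner u x <= enorm x.
Proof.
move=> u1; apply: le_trans (ler_norm _) _.
by rewrite -[leRHS]mul1r -u1 inner_CauchySchwarz.
Qed.

Lemma exists_unit_direction z : 0 < enorm z ->
  exists2 u, enorm u = 1 & inner u z = enorm z.
Proof.
move=> z_gt0; pose u := [tuple (enorm z)^-1 * tnth z i | i < d].
have innerE y : inner u y = (enorm z)^-1 * inner z y.
  rewrite /inner mulr_sumr; apply: eq_bigr => i _.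
  by rewrite tnth_mktuple mulrA.
have uz : inner u z = enorm z by rewrite innerE -sqr_enorm mulKf// gt_eqF.
by exists u; rewrite // /enorm innerE innerC uz mulVf ?sqrtr1// gt_eqF.
Qed.

Lemma halfspace_center u z : halfspace u z z.
Proof. by rewrite /halfspace/= inner_vsubr subrr. Qed.

Lemma halfspace_sub_enorm_ge u z : enorm u = 1 ->
  halfspace u z `<=` [set x | inner u z <= enorm x].
Proof.
move=> u1 x; rewrite /halfspace/= inner_vsubr subr_ge0 => /le_trans; apply.
exact: inner_le_enorm.
Qed.

End euclidean_space_theory.

#[local] Hint Resolve EFin_enorm_ge0 : core.

Lemma measurable_superlevel (R : realType) (disp : measure_display)
    (T : measurableType disp) (f : T -> R) (a : R) :
  measurable_fun setT f -> measurable [set t | a <= f t].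
Proof.
move=> /measurable_EFinP mf; rewrite -[X in measurable X]setTI.
by under eq_set do rewrite -lee_fin; exact: emeasurable_fun_c_infty.
Qed.

Section euclidean_space_measurability.
Variables (R : realType) (d : nat) (disp : measure_display).
Variable T : measurableType disp.
Implicit Types f g : T -> d.-tuple R.

Lemma measurable_tnth_comp f i :
  measurable_fun setT f -> measurable_fun setT (fun t => tnth (f t) i).
Proof. exact: measurableT_comp (measurable_tnth i). Qed.

Lemma measurable_inner f g : measurable_fun setT f -> measurable_fun setT g ->
  measurable_fun setT (fun t => inner (f t) (g t)).
Proof.
move=> mf mg; apply: measurable_sum => i.
by apply: measurable_funM; exact: measurable_tnth_comp.
Qed.

Lemma measurable_enorm f : measurable_fun setT f ->
  measurable_fun setT (fun t => enorm (f t)).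
Proof.
move=> mf; apply: (measurableT_comp (f := @Num.sqrt R)).
  by apply: continuous_measurable_fun; exact: sqrt_continuous.
exact: measurable_inner.
Qed.

Lemma measurable_vsub f g : measurable_fun setT f -> measurable_fun setT g ->
  measurable_fun setT (fun t => vsub (f t) (g t)).
Proof.
move=> mf mg; apply/measurable_fun_tnthP => i.
apply: (eq_measurable_fun (fun t => tnth (f t) i - tnth (g t) i)) => [t _|].
  by rewrite /= tnth_mktuple.
by apply: measurable_funB; exact: measurable_tnth_comp.
Qed.

End euclidean_space_measurability.

Lemma emeasurable_enorm (R : realType) (d : nat) :
  measurable_fun setT (fun x : d.-tuple R => (enorm x)%:E).
Proof. exact/measurable_EFinP/measurable_enorm. Qed.
Arguments emeasurable_enorm {R d}.

Lemma measurable_halfspace (R : realType) (d : nat) (u z : d.-tuple R) :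
  measurable (halfspace u z).
Proof.
by apply: measurable_superlevel; apply: measurable_inner => //;
  exact: measurable_vsub.
Qed.

Section mixture.
Local Open Scope ereal_scope.
Context (disp : measure_display) (T : measurableType disp) (R : realType).
Variables (p : {i01 R}) (P0 P1 : probability T R).

Definition mixture : set T -> \bar R :=
  measure_add (mscale (1 - p%:num)%:nng%R P0) (mscale p%:num%:nng%R P1).

HB.instance Definition _ := Measure.on mixture.

Lemma mixtureE A : mixture A = (1 - p%:num)%:E * P0 A + p%:num%:E * P1 A.
Proof. by rewrite /mixture measure_addE. Qed.

Let mixture_setT : mixture setT = 1.
Proof. by rewrite mixtureE !probability_setT !mule1 -EFinD subrK. Qed.

HB.instance Definition _ := Measure_isProbability.Build _ _ _
  mixture mixture_setT.

Lemma ge0_integral_mixture (f : T -> \bar R) :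
  measurable_fun setT f -> (forall x, 0 <= f x) ->
  \int[mixture]_x f x =
    (1 - p%:num)%:E * \int[P0]_x f x + p%:num%:E * \int[P1]_x f x.
Proof.
by move=> mf f0; rewrite ge0_integral_measure_add// !ge0_integral_mscale.
Qed.

End mixture.

Section idfun_measurable.
Context (disp : measure_display) (T : measurableType disp).

HB.instance Definition _ :=
  isMeasurableFun.Build disp disp T T idfun (@measurable_id _ T setT).

End idfun_measurable.

Section joint_law.
Context (disp disp1 disp2 : measure_display) (T : measurableType disp)
  (T1 : measurableType disp1) (T2 : measurableType disp2) (R : realType).
Variables (P : probability T R) (f : {mfun T >-> T1}) (g : {mfun T >-> T2}).

Let measurable_pairing : measurable_fun setT (fun t => (f t, g t)).
Proof. exact: measurable_fun_pair. Qed.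

Definition joint_law : probability (T1 * T2)%type R :=
  distribution P (mfun_Sub (mem_set measurable_pairing)).

Lemma ge0_integral_joint_law (h : T1 * T2 -> \bar R) :
  measurable_fun setT h -> (forall w, 0 <= h w)%E ->
  (\int[joint_law]_w h w = \int[P]_t h (f t, g t))%E.
Proof. exact: ge0_integral_distribution. Qed.

End joint_law.

Section first_moment.
Local Open Scope ereal_scope.
Context (R : realType) (d : nat).
Implicit Types P : probability (d.-tuple R) R.

Definition first_moment P : \bar R := \int[P]_x (enorm x)%:E.

Lemma first_moment_ge0 P : 0 <= first_moment P.
Proof. exact: integral_ge0. Qed.

Lemma first_moment_distribution (disp : measure_display)
    (Omega : measurableType disp) (Q : probability Omega R)
    (X : {RV Q >-> d.-tuple R}) :
  first_moment (distribution Q X) = 'E_Q[fun w => enorm (X w)].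
Proof.
rewrite unlock [LHS]ge0_integral_distribution//; exact: emeasurable_enorm.
Qed.

Lemma markov_enorm P a : (0 < a)%R ->
  a%:E * P [set x | a <= enorm x]%R <= first_moment P.
Proof.
move=> a_gt0.
have := le_integral_abse P measurableT emeasurable_enorm a_gt0.
rewrite setTI; under eq_integral do rewrite gee0_abs//.
by under eq_set do rewrite gee0_abs// lee_fin.
Qed.

Lemma markov_halfspace P u z : enorm u = 1%R -> (0 < inner u z)%R ->
  (inner u z)%:E * P (halfspace u z) <= first_moment P.
Proof.
move=> u1 uz_gt0; apply: le_trans (markov_enorm P uz_gt0).
rewrite lee_pmul2l// le_measure ?inE//.
- exact: measurable_halfspace.
- by apply: measurable_superlevel; exact: measurable_enorm.
- exact: halfspace_sub_enorm_ge.
Qed.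

End first_moment.

Section wasserstein_theory.
Local Open Scope ereal_scope.
Context (R : realType) (d : nat).
Local Notation E := (d.-tuple R).
Implicit Types (P : probability E R) (Pi : probability (E * E)%type R).

Definition transport_cost Pi : \bar R := \int[Pi]_w (enorm (vsub w.1 w.2))%:E.

Let measurable_cost :
  measurable_fun setT (fun w : E * E => (enorm (vsub w.1 w.2))%:E).
Proof. exact/measurable_EFinP/measurable_enorm/measurable_vsub. Qed.

Lemma wasserstein_ge0 P P' : 0 <= wasserstein P P'.
Proof. by apply: le_ereal_inf_tmp => _ [Pi _ <-]; exact: integral_ge0. Qed.

Lemma wasserstein_le P P' Pi :
  coupling P P' Pi -> wasserstein P P' <= transport_cost Pi.
Proof. by move=> cPi; apply: ereal_inf_lbound; exists Pi. Qed.

Lemma ge0_integral_coupling_fst P P' Pi (f : E -> \bar R) : coupling P P' Pi ->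
  measurable_fun setT f -> (forall x, 0 <= f x) ->
  \int[Pi]_w f w.1 = \int[P]_x f x.
Proof.
move=> cPi mf f_ge0.
rewrite -[LHS](ge0_integral_pushforward measurable_fst Pi measurableT mf)//.
by apply: eq_measure_integral => A mA _; exact: (cPi A mA).1.
Qed.

Lemma ge0_integral_coupling_snd P P' Pi (f : E -> \bar R) : coupling P P' Pi ->
  measurable_fun setT f -> (forall x, 0 <= f x) ->
  \int[Pi]_w f w.2 = \int[P']_x f x.
Proof.
move=> cPi mf f_ge0.
rewrite -[LHS](ge0_integral_pushforward measurable_snd Pi measurableT mf)//.
by apply: eq_measure_integral => A mA _; exact: (cPi A mA).2.
Qed.

Lemma first_moment_le_transport_cost P P' Pi : coupling P P' Pi ->
  first_moment P <= transport_cost Pi + first_moment P'.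
Proof.
move=> cPi.
rewrite /first_moment -(ge0_integral_coupling_fst cPi emeasurable_enorm)//.
rewrite -(ge0_integral_coupling_snd cPi emeasurable_enorm)//.
have measurable_enorm_fst :
    measurable_fun setT (fun w : E * E => (enorm w.1)%:E).
  exact: measurableT_comp emeasurable_enorm _.
have measurable_enorm_snd :
    measurable_fun setT (fun w : E * E => (enorm w.2)%:E).
  exact: measurableT_comp emeasurable_enorm _.
rewrite -ge0_integralD//; apply: ge0_le_integral => //.
- exact: emeasurable_funD.
- by move=> w _; rewrite -EFinD lee_fin -lerBlDr lerB_enormB.
Qed.

Lemma first_moment_le_wasserstein P P' :
  first_moment P <= wasserstein P P' + first_moment P'.
Proof.
have [finP'|] := boolP (first_moment P' \is a fin_num); last first.
  rewrite ge0_fin_numE ?first_moment_ge0// -leNgt leye_eq => /eqP ->.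
  by rewrite addey ?leey// gt_eqF// (lt_le_trans _ (wasserstein_ge0 _ _)).
rewrite -leeBlDr//; apply: le_ereal_inf_tmp => _ [Pi cPi <-].
by rewrite leeBlDr//; exact: first_moment_le_transport_cost.
Qed.

Lemma wasserstein_dirac_le P z :
  wasserstein \d_z P <= (enorm z)%:E + first_moment P.
Proof.
have couplingP : coupling \d_z P (joint_law P (cst z) idfun).
  move=> A mA; split=> //.
  rewrite [LHS](_ : _ = P (cst z @^-1` A))// preimage_cst /= diracE.
  by case: ifP; rewrite ?probability_setT ?measure0.
apply: le_trans (wasserstein_le couplingP) _.
rewrite [leLHS]ge0_integral_joint_law//=.
have <- : \int[P]_x (enorm z)%:E = (enorm z)%:E.
  by rewrite integral_cst//= probability_setT mule1.
rewrite -ge0_integralD//; last exact: emeasurable_enorm.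
apply: ge0_le_integral => //.
- exact/measurable_EFinP/measurable_enorm/measurable_vsub.
- by apply: emeasurable_funD => //; exact: emeasurable_enorm.
- by move=> x _; rewrite -EFinD lee_fin ler_enormB.
Qed.

(* The mass kept from [P] stays in place, coupled to itself on the diagonal. *)
Lemma coupling_contamination (p : {i01 R}) P P1 Pi : coupling P1 P Pi ->
  coupling (mixture p P P1) P (mixture p (joint_law P idfun idfun) Pi).
Proof.
move=> cPi A mA; have [PiA1 PiA2] := cPi A mA.
rewrite /pushforward /= !mixtureE -PiA1; split=> //.
rewrite -[Pi _]/(pushforward Pi snd A) PiA2.
by rewrite -ge0_muleDl ?lee_fin// ?subr_ge0//= -EFinD subrK mul1e.
Qed.

Lemma wasserstein_contamination (p : {i01 R}) P P1 : (0 < p%:num)%R ->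
  wasserstein (mixture p P P1) P <= p%:num%:E * wasserstein P1 P.
Proof.
move=> p_gt0; rewrite -ereal_inf_pZl//.
apply: le_ereal_inf_tmp => _ [_ [Pi cPi <-] <-].
apply: le_trans (wasserstein_le (coupling_contamination p cPi)) _.
rewrite /transport_cost ge0_integral_mixture// ge0_integral_joint_law//=.
under eq_integral do rewrite enorm_vsubxx.
by rewrite integral0 mule0 add0e.
Qed.

End wasserstein_theory.

Section robust_depth_bounds.
Local Open Scope ereal_scope.
Context (R : realType) (d : nat) (delta : R).
Implicit Types (P : probability (d.-tuple R) R) (z : d.-tuple R).

Lemma robust_depth_le P z : (0 < enorm z)%R ->
  robust_depth delta P z <= (enorm z)^-1%:E * (delta%:E + first_moment P).
Proof.
move=> z_gt0; have [u u1 uz] := exists_unit_direction z_gt0.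
apply: (@le_trans _ _ _ _ _ (ereal_inf_lbound _)); first by exists u.
apply: ge_ereal_sup => _ [P' /= P'P <-].
rewrite muleC lee_pdivlMr// muleC -[in leLHS]uz.
apply: le_trans; first by apply: markov_halfspace; rewrite ?uz.
by apply: le_trans (first_moment_le_wasserstein P' P) _; rewrite leeD2r.
Qed.

Lemma robust_depth_ge_contamination (p : {i01 R}) P z : (0 < p%:num)%R ->
  p%:num%:E * wasserstein \d_z P <= delta%:E ->
  p%:num%:E <= robust_depth delta P z.
Proof.
move=> p_gt0 pW; apply: le_ereal_inf_tmp => _ [u u1 <-].
apply: (@le_trans _ _ (mixture p P \d_z (halfspace u z))).
  rewrite mixtureE /= diracE mem_set; last exact: halfspace_center.
  by rewrite mule1 leeDr// mule_ge0// lee_fin subr_ge0.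
apply: ereal_sup_ubound; exists (mixture p P \d_z) => //=.
exact: le_trans (wasserstein_contamination P \d_z p_gt0) pW.
Qed.

Lemma robust_depth_ge (p : R) P z : (0 < p <= 1)%R ->
  p%:E * ((enorm z)%:E + first_moment P) <= delta%:E ->
  p%:E <= robust_depth delta P z.
Proof.
move=> /andP[p_gt0 p_le1] cost.
apply: (@robust_depth_ge_contamination (Itv01 (ltW p_gt0) p_le1)) => //=.
by apply: le_trans cost; rewrite lee_pmul2l// wasserstein_dirac_le.
Qed.

End robust_depth_bounds.

Theorem corollary2 (R : realType) (d : nat) (hd : (1 <= d)%N)
    (disp : measure_display) (Omega : measurableType disp)
    (Q : probability Omega R) (X : {RV Q >-> d.-tuple R})
    (hX : ('E_Q[fun w => enorm (X w)] < +oo)%E)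
    (delta : R) (hdelta : 0 < delta) :
  exists c1 c2 : R,
    [/\ 0 < c1, c1 < c2 &
      exists r : R, forall z : d.-tuple R, r <= enorm z ->
        ((c1 * (enorm z)^-1)%:E <= robust_depth delta (distribution Q X) z /\
         robust_depth delta (distribution Q X) z <= (c2 * (enorm z)^-1)%:E)%E].
Proof.
have [m m_ge0 mE] : exists2 m : R, 0 <= m &
    first_moment (distribution Q X) = m%:E.
  have := first_moment_ge0 (distribution Q X).
  move: hX; rewrite -first_moment_distribution.
  by case: first_moment => // m _; exists m.
exists (delta / 2), (delta + m); split; [lra|lra|].
exists (delta + m) => z z_large; have z_gt0 : 0 < enorm z by lra.
split.
- apply: robust_depth_ge.
    by rewrite divr_gt0 ?divr_gt0//= ler_pdivrMr//; lra.
  rewrite mE -EFinD -EFinM lee_fin mulrAC ler_pdivrMr//.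
  have : enorm z + m <= 2 * enorm z by lra.
  by nra.
- apply: le_trans (robust_depth_le _ _ z_gt0) _.
  by rewrite mE -EFinD -EFinM mulrC.
Qed.
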